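(* Consider the closed-loop system defined in the context, and a steady state $(\bar\theta,\bar\Omega,\bar v,\bar\lambda,\bar\zeta)$ of it with synchronization frequency $\omega_{\rm syn}$, with corresponding $\bar V$, $\bar P$, $\bar Q$. Let $\mathcal{N}=\{1,\dots,n\}$, $\mathcal{N}_{\rm sat}=\{i\in\mathcal{N}\mid\rho_i(\bar v_i)>0\}$, and $\alpha_Q=\tfrac1n1_n^\top S^{-1}\bar Q$. If there is $m_\star>0$ such that $m_i^\omega=m_\star$ for all $i\in\mathcal{N}$, then: 1. (Active power sharing and frequency regulation) $\bar P_i/S_i^{\rm rated}=\bar P_j/S_j^{\rm rated}$ for all $i,j\in\mathcal{N}$, and $\omega_{\rm syn}=\omega_{\rm nom}-m_\star\tfrac1n1_n^\top S^{-1}\bar P$. 2. (Voltage containment) $\bar V_i\in(V_i^{\min},V_i^{\max})$ for all $i\in\mathcal{N}$. 3. (Global reactive power sharing) If $\mathcal{N}_{\rm sat}=\emptyset$, then $$|\bar Q_i/S_i^{\rm rated}-\alpha_Q|=\beta\,|1-\bar V_i/V_i^\star|\qquad\forall i\in\mathcal{N}.$$ 4. (Partial reactive power sharing) If $\mathcal{N}_{\rm sat}\ne\emptyset$, then $$|\bar Q_i/S_i^{\rm rated}-\alpha_Q|=\beta\,|1-\bar V_i/V_i^\star|\qquad\forall i\in\mathcal{N}\setminus\mathcal{N}_{\rm sat},$$ $$|\bar Q_i/S_i^{\rm rated}-\alpha_Q|\le\beta\,|1-\bar V_i/V_i^\star|+\rho_i(\bar v_i)\,|\bar v_i/V_i^\star|\qquad\forall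 i\in\mathcal{N}_{\rm sat}.$$
   Context: **Communication graph.** $\mathcal{L}\in\mathbb{R}^{n\times n}$ is the Laplacian $\mathcal{L}=\mathcal{D}-\mathcal{A}$ of an undirected connected graph on $\{1,\dots,n\}$ with adjacency matrix $\mathcal{A}=[a_{ij}]$, where $a_{ij}=a_{ji}=1$ if $i,j$ are neighbors and $a_{ij}=a_{ji}=0$ otherwise, and $\mathcal{D}=\mathrm{diag}(\sum_j a_{ij})$. **Parameters.** $\tau_\Omega,\tau_v,\tau_p,\tau_d,\beta,k>0$ and $\omega_{\rm nom}\in\mathbb{R}$ are scalars; $m=\mathrm{diag}(m_1^\omega,\dots,m_n^\omega)$; $S=\mathrm{diag}(S_1^{\rm rated},\dots,S_n^{\rm rated})$ with $S_i^{\rm rated}>0$. For voltage limits $0<V_i^{\min}<V_i^{\max}$, put $V_i^\star=\tfrac12(V_i^{\max}+V_i^{\min})$, $\Delta_i=\tfrac12(V_i^{\max}-V_i^{\min})$, $V_\star=\mathrm{col}(V_1^\star,\dots,V_n^\star)$, $[V_\star]=\mathrm{diag}(V_1^\star,\dots,V_n^\star)$, $\Delta=\mathrm{diag}(\Delta_1,\dots,\Delta_n)$. $\boldsymbol{\tanh}$ is $\tanh$ applied entrywise; $1_n$ and $0_n$ are the all-ones and zero vectors in $\mathbb{R}^n$. $\rho(v)=\mathrm{diag}(\rho_1(v_1),\dots,\rho_n(v_n))$, where $\rho_i(v_i)=|v_i/\Delta_i|-3$ if $|v_i|>3\Delta_i$ and $\rho_i(v_i)=0$ otherwise. **Closed-loop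 system.** The states are $\theta,\Omega,v,\lambda,\zeta\in\mathbb{R}^n$ and $$\begin{aligned}\dot\theta&=\omega_{\rm nom}1_n+\Omega,\\ \tau_\Omega\dot\Omega&=-\Omega-mS^{-1}P,\\ \tau_v\dot v&=-\rho(v)v-\beta\Delta\boldsymbol{\tanh}(\Delta^{-1}v)+[V_\star](\lambda-S^{-1}Q),\\ \tau_p\dot\lambda&=-k\mathcal{L}\lambda-\mathcal{L}\zeta+(S^{-1}Q-\lambda),\\ \tau_d\dot\zeta&=\mathcal{L}\lambda,\end{aligned}$$ with $V=V_\star+\Delta\boldsymbol{\tanh}(\Delta^{-1}v)$, $P=f_P(\theta,V)$, $Q=f_Q(\theta,V)$, where, for given real constants $G_{ij},B_{ij}$ and $\theta_{ij}=\theta_i-\theta_j$, the $i$-th components of $f_P$ and $f_Q$ are $$f_i^P(\theta,V)=\sum_{j=1}^nV_iV_j\big(G_{ij}\cos\theta_{ij}+B_{ij}\sin\theta_{ij}\big),\qquad f_i^Q(\theta,V)=\sum_{j=1}^nV_iV_j\big(G_{ij}\sin\theta_{ij}-B_{ij}\cos\theta_{ij}\big).$$ **Steady state.** A steady state with synchronization frequency $\omega_{\rm syn}\in\mathbb{R}$ is a solution along which $\dot{\bar\theta}=\omega_{\rm syn}1_n$ and $\bar\Omega,\bar v,\bar\lambda,\bar\zeta$ are constant; overbars denote steady-state values, with $\bar V=V_\star+\Delta\boldsymbol{\tanh}(\Delta^{-1}\bar v)$, $\bar P=f_P(\bar\theta,\bar V)$, $\bar Q=f_Q(\bar\theta,\bar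 V)$ (which are constant, since $f_P,f_Q$ depend on $\theta$ only through differences). *)

(* Defs.v *)
From HB Require Import structures.
From mathcomp Require Import all_boot all_order all_algebra.
From mathcomp Require Import all_classical reals topology normedtype.
From mathcomp Require Import sequences derive exp trigo.

Set Implicit Arguments.
Unset Strict Implicit.
Unset Printing Implicit Defensive.

Import Order.TTheory GRing.Theory Num.Theory.
Import numFieldNormedType.Exports.

Local Open Scope classical_set_scope.
Local Open Scope ring_scope.

Definition tanh {R : realType} (x : R) : R :=
  (expR x - expR (- x)) / (expR x + expR (- x)).

Definition ones {R : realType} (n : nat) : 'cV[R]_n := const_mx 1.

Definition dg {R : realType} {n : nat} (x : 'cV[R]_n) : 'M[R]_n := diag_mx x^T.

Definition average {R : realType} {n : nat} (x : 'cV[R]_n) : R :=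
  n%:R^-1 * ((ones n)^T *m x) 0 0.

(* [droop] is the vector of the m_i^omega.  No sign is imposed on it, nor any
   structure on G and B. *)
Record microgrid (R : realType) (n : nat) := Microgrid {
  neighbor : rel 'I_n;
  neighbor_sym : symmetric neighbor;
  neighbor_irr : irreflexive neighbor;
  neighbor_connected : forall i j, connect neighbor i j;
  tau_Omega : R;
  tau_v : R;
  tau_p : R;
  tau_d : R;
  beta : R;
  kgain : R;
  omega_nom : R;
  tau_Omega_gt0 : 0 < tau_Omega;
  tau_v_gt0 : 0 < tau_v;
  tau_p_gt0 : 0 < tau_p;
  tau_d_gt0 : 0 < tau_d;
  beta_gt0 : 0 < beta;
  kgain_gt0 : 0 < kgain;
  droop : 'cV[R]_n;
  Srated : 'cV[R]_n;
  Srated_gt0 : forall i, 0 < Srated i 0;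
  Vmin : 'cV[R]_n;
  Vmax : 'cV[R]_n;
  Vmin_gt0 : forall i, 0 < Vmin i 0;
  Vmin_lt_Vmax : forall i, Vmin i 0 < Vmax i 0;
  Gmat : 'M[R]_n;
  Bmat : 'M[R]_n }.

Section ClosedLoop.
Context {R : realType} {n : nat} (g : microgrid R n).
Implicit Types theta Omega v lambda zeta V P Q : 'cV[R]_n.

Definition adjacency : 'M[R]_n := \matrix_(i, j) (neighbor g i j)%:R.

Definition laplacian : 'M[R]_n :=
  diag_mx (\row_i \sum_j adjacency i j) - adjacency.

Definition Vstar : 'cV[R]_n := \col_i (2^-1 * (Vmax g i 0 + Vmin g i 0)).

Definition Delta : 'cV[R]_n := \col_i (2^-1 * (Vmax g i 0 - Vmin g i 0)).

Definition Sinv : 'M[R]_n := invmx (dg (Srated g)).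

Definition rho (i : 'I_n) (x : R) : R :=
  if 3 * Delta i 0 < `|x| then `|x / Delta i 0| - 3 else 0.

Definition rho_mx v : 'M[R]_n := dg (\col_i rho i (v i 0)).

Definition saturation v : 'cV[R]_n :=
  dg Delta *m map_mx tanh (invmx (dg Delta) *m v).

Definition voltage v : 'cV[R]_n := Vstar + saturation v.

Definition fP theta V : 'cV[R]_n :=
  \col_i \sum_j V i 0 * V j 0 *
    (Gmat g i j * cos (theta i 0 - theta j 0)
     + Bmat g i j * sin (theta i 0 - theta j 0)).

Definition fQ theta V : 'cV[R]_n :=
  \col_i \sum_j V i 0 * V j 0 *
    (Gmat g i j * sin (theta i 0 - theta j 0)
     - Bmat g i j * cos (theta i 0 - theta j 0)).

Definition closed_loop_at (theta Omega v lambda zeta : R -> 'cV[R]_n) (t : R)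
    : Prop :=
  let P := fP (theta t) (voltage (v t)) in
  let Q := fQ (theta t) (voltage (v t)) in
  [/\ derive1 theta t = omega_nom g *: ones n + Omega t,
      tau_Omega g *: derive1 Omega t = - Omega t - dg (droop g) *m Sinv *m P,
      tau_v g *: derive1 v t =
        - (rho_mx (v t) *m v t) - beta g *: saturation (v t)
        + dg Vstar *m (lambda t - Sinv *m Q),
      tau_p g *: derive1 lambda t =
        - (kgain g *: (laplacian *m lambda t)) - laplacian *m zeta t
        + (Sinv *m Q - lambda t)
    & tau_d g *: derive1 zeta t = laplacian *m lambda t].

(* Derivability must be required separately: [derive1] is a total function. *)
Definition regular (x : R -> 'cV[R]_n) : Prop :=
  {within `[0, +oo[, continuous x} /\ forall t : R, 0 < t -> derivable x t 1.

Definition closed_loop_solution (theta Omega v lambda zeta : R -> 'cV[R]_n)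
    : Prop :=
  [/\ regular theta, regular Omega, regular v, regular lambda & regular zeta]
  /\ forall t : R, 0 < t -> closed_loop_at theta Omega v lambda zeta t.

(* Only the angles move along a steady state; the other components are given by
   their constant values. *)
Definition steady_state (omega_syn : R) (theta : R -> 'cV[R]_n)
    Omega v lambda zeta : Prop :=
  closed_loop_solution theta (cst Omega) (cst v) (cst lambda) (cst zeta)
  /\ forall t : R, 0 < t -> derive1 theta t = omega_syn *: ones n.

Definition Nsat v : {set 'I_n} := [set i | 0 < rho i (v i 0)]%SET.

End ClosedLoop.

(* Main.v *)
(* At a steady state every time derivative but that of [theta] vanishes.  The
   frequency equation makes [m_star P_i / S_i] equal to
   [omega_nom - omega_syn] at every node.  Connectedness turns
   [laplacian *m lambda = 0] into consensus, and summing the lambda equation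
   over the nodes kills the Laplacian terms, so the consensus value is
   [alpha_Q]; the voltage equation then gives the reactive power deviation
   explicitly. *)
From mathcomp Require Import all_classical topology normedtype.
From mathcomp Require Import sequences derive exp trigo ring lra.
Require Import Defs.
From mathcomp Require Import all_boot all_order all_algebra.
From mathcomp Require Import reals.

Set Implicit Arguments.
Unset Strict Implicit.
Unset Printing Implicit Defensive.

Import Order.TTheory GRing.Theory Num.Theory.
Import numFieldNormedType.Exports.

Local Open Scope ring_scope.

(** * Hyperbolic tangent, diagonal matrices, averages and synchronized angles *)

Lemma normr_tanh_lt1 (R : realType) (x : R) : `|tanh x| < 1.
Proof.
have a0 := expR_gt0 x; have b0 := expR_gt0 (- x).
have ab : 0 < expR x + expR (- x) by lra.
rewrite /tanh normrM normfV (gtr0_norm ab) ltr_pdivrMr// mul1r ltr_norml.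
by apply/andP; split; lra.
Qed.

Lemma dg_mulE (R : realType) n (x y : 'cV[R]_n) i :
  (dg x *m y) i 0 = x i 0 * y i 0.
Proof. by rewrite mul_diag_mx !mxE. Qed.

Lemma invmx_dg_mulE (R : realType) n (x y : 'cV[R]_n) i :
  (forall j, 0 < x j 0) -> (invmx (dg x) *m y) i 0 = y i 0 / x i 0.
Proof.
move=> x0; have xU : dg x \in unitmx.
  rewrite unitmxE det_diag unitfE prodf_seq_neq0; apply/allP => j _ /=.
  by rewrite mxE gt_eqF.
have -> : y = dg x *m (\col_j (y j 0 / x j 0)).
  apply/matrixP => j k; rewrite (ord1 k) dg_mulE mxE mulrC divfK//.
  by rewrite gt_eqF.
by rewrite mulKmx// mxE dg_mulE mxE [x i 0 * _]mulrC divfK// gt_eqF.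
Qed.

Lemma averageE (R : realType) n (x : 'cV[R]_n) :
  average x = n%:R^-1 * \sum_i x i 0.
Proof.
by rewrite /average mxE; under eq_bigr do rewrite !mxE mul1r.
Qed.

Lemma average_const (R : realType) n (x : 'cV[R]_n) (c : R) :
  (0 < n)%N -> (forall i, x i 0 = c) -> average x = c.
Proof.
move=> n0 xc; rewrite averageE (eq_bigr (fun=> c)) => [|i _]; last exact: xc.
by rewrite sumr_const card_ord -[c *+ n]mulr_natl mulKf// pnatr_eq0 -lt0n.
Qed.

(** All entries have derivative [c], so a difference of two has zero derivative on the open
    half-line. The mean value theorem needs only continuity at the endpoints, which brings in the
    time [0]. *)
Lemma entry_sub_constant (R : realType) n (x : R -> 'cV[R]_n) (c : R) :
  regular x -> (forall t : R, 0 < t -> derive1 x t = c *: ones n) ->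
  forall i j (t : R), 0 <= t -> x t i 0 - x t j 0 = x 0 i 0 - x 0 j 0.
Proof.
move=> [xcont xder] xc i j t t0.
pose f := (fun s : R => x s i 0) - (fun s : R => x s j 0).
have fder s : s \in `]0, t[ -> is_derive s 1 f 0.
  rewrite in_itv/= => /andP[s0 _].
  have dx := xder s s0; have /derivable_mxP dxe := dx.
  have xE k : 'D_1 (fun s => x s k 0) s = c.
    have := xc s s0; rewrite derive1E (derive_mx dx) => /matrixP/(_ k 0).
    by rewrite !mxE mulr1.
  apply: DeriveDef; first exact: derivableB.
  by rewrite deriveB// !xE subrr.
have fcont : ({within `[0, t], continuous f})%classic.
  have sub : (`[0, t]%classic `<=` `[0, +oo[%classic)%classic.
    by move=> s /=; rewrite !in_itv/= => /andP[-> _].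
  have xk k : ({within `[0, t], continuous (fun s => x s k 0%R)})%classic.
    move=> s; apply: (continuous_comp (f := x : subspace _ -> 'cV[R]_n)
                                      (g := fun M : 'cV[R]_n => M k 0)).
      exact: (continuous_subspaceW sub xcont).
    exact: coord_continuous.
  by move=> s; apply: (@continuousB _ _ _ _ _ s (xk i s) (xk j s)).
have [s _ ] := MVT_segment t0 fder fcont.
by rewrite mul0r => /eqP; rewrite subr_eq0 => /eqP.
Qed.

Section SteadyState.
Context {R : realType} {n : nat} (g : microgrid R n).

(** * The graph Laplacian *)

Lemma laplacianE (x : 'cV[R]_n) i :
  (laplacian g *m x) i 0 = \sum_j (neighbor g i j)%:R * (x i 0 - x j 0).
Proof.
rewrite mulmxBl mxE [(- (_ *m x)) _ _]mxE mul_diag_mx !mxE.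
under eq_bigr do rewrite mxE.
rewrite mulr_suml -sumrB; apply: eq_bigr => j _.
by rewrite mxE mulrBr.
Qed.

(** As the graph is symmetric, exchanging the two indices turns the double sum into its own
    opposite. *)
Lemma sum_laplacian (x : 'cV[R]_n) : \sum_i (laplacian g *m x) i 0 = 0.
Proof.
under eq_bigr do rewrite laplacianE; rewrite pair_big /=.
set s := \sum_p _; suff : s = - s by move=> ?; lra.
rewrite {1}/s (reindex_inj (h := fun p : 'I_n * 'I_n => (p.2, p.1))) /=.
  rewrite -sumrN; apply: eq_bigr => p _.
  by rewrite (neighbor_sym g) -mulrN opprB.
by move=> [a b] [c d] [-> ->].
Qed.

(* Maximum principle: the set where [x] is maximal is closed under adjacency. *)
Lemma laplacian_ker (x : 'cV[R]_n) :
  laplacian g *m x = 0 -> forall i j, x i 0 = x j 0.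
Proof.
move=> Lx0.
suff H i j : (forall k, x k 0 <= x i 0) -> x j 0 = x i 0.
  move=> i j.
  have [M _ Mmax] := @arg_maxP _ _ _ i predT (fun k => x k 0) isT.
  by rewrite (H M i) ?(H M j)// => k; exact: Mmax.
move=> imax; have /connectP[p] := neighbor_connected g i j.
elim: p i imax => [|k p IH] i imax /=; first by move=> _ ->.
move=> /andP[ik kp] jlast.
suff xk : x k 0 = x i 0 by rewrite -xk; apply: IH => // l; rewrite xk.
(* At a maximum the Laplacian sum has nonnegative terms and total zero, so the term of the neighbour
   [k] vanishes. *)
have /eqP := laplacianE x i; rewrite Lx0 mxE eq_sym psumr_eq0 => [|l _].
  move=> /allP/(_ k); rewrite mem_index_enum ik mul1r subr_eq0 => /(_ isT).
  by move=> /eqP.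
by rewrite mulr_ge0 ?ler0n// subr_ge0.
Qed.

(** * Voltage limits and saturation *)

Lemma Delta_gt0 i : 0 < Delta g i 0.
Proof. by rewrite mxE; have := Vmin_lt_Vmax g i; lra. Qed.

Lemma Vstar_gt0 i : 0 < Vstar g i 0.
Proof.
by rewrite mxE; have := Vmin_lt_Vmax g i; have := Vmin_gt0 g i; lra.
Qed.

Lemma SinvE (y : 'cV[R]_n) i : (Sinv g *m y) i 0 = y i 0 / Srated g i 0.
Proof. exact/invmx_dg_mulE/Srated_gt0. Qed.

(** Outside [Nsat] this forces [rho] to be exactly zero; inside, it removes the absolute value
    around [rho]. *)
Lemma rho_ge0 i (x : R) : 0 <= rho g i x.
Proof.
rewrite /rho; case: ifP => // x3; have D0 := Delta_gt0 i.
by rewrite normrM normfV (gtr0_norm D0) subr_ge0 ler_pdivlMr// ltW.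
Qed.

(** [Vstar] is the midpoint and [Delta] the half-width of the interval, so the strict bound on
    [tanh] suffices. *)
Lemma voltage_bounds (v : 'cV[R]_n) i :
  Vmin g i 0 < voltage g v i 0 < Vmax g i 0.
Proof.
rewrite mxE dg_mulE [map_mx _ _ _ _]mxE.
set y := tanh _; have := normr_tanh_lt1 ((invmx (dg (Delta g)) *m v) i 0).
rewrite -/y ltr_norml => /andP[y1 y2].
have := Vmin_lt_Vmax g i; rewrite !mxE; move: (Vmin g i 0) (Vmax g i 0) => a b ab.
by apply/andP; split; nra.
Qed.

Lemma fP_shift (theta theta' V : 'cV[R]_n) :
  (forall i j, theta i 0 - theta j 0 = theta' i 0 - theta' j 0) ->
  fP g theta V = fP g theta' V.
Proof.
by move=> th; apply/matrixP => i k; rewrite !mxE; under eq_bigr do rewrite th.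
Qed.

Lemma fQ_shift (theta theta' V : 'cV[R]_n) :
  (forall i j, theta i 0 - theta j 0 = theta' i 0 - theta' j 0) ->
  fQ g theta V = fQ g theta' V.
Proof.
by move=> th; apply/matrixP => i k; rewrite !mxE; under eq_bigr do rewrite th.
Qed.

(** * Steady-state equations and their consequences *)

Variables (omega_syn : R) (theta : R -> 'cV[R]_n) (Omega v lambda zeta : 'cV[R]_n).
Hypothesis ss : steady_state g omega_syn theta Omega v lambda zeta.

(* The closed-loop equations say nothing at [t = 0]; there the powers are
   recovered from the angle differences, which are constant on [0, +oo[. *)
Lemma steady_state_equations (t : R) : 0 <= t ->
  let P := fP g (theta t) (voltage g v) in
  let Q := fQ g (theta t) (voltage g v) in
  [/\ omega_syn *: ones n = omega_nom g *: ones n + Omega,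
      - Omega - dg (droop g) *m Sinv g *m P = 0,
      - (rho_mx g v *m v) - beta g *: saturation g v
        + dg (Vstar g) *m (lambda - Sinv g *m Q) = 0,
      - (kgain g *: (laplacian g *m lambda)) - laplacian g *m zeta
        + (Sinv g *m Q - lambda) = 0
    & laplacian g *m lambda = 0].
Proof.
move=> t0; have [[[thr _ _ _ _] cl] th'] := ss.
(* The time [1] stands for any positive instant, where the dynamics can be evaluated. *)
have thE i j : theta t i 0 - theta t j 0 = theta 1 i 0 - theta 1 j 0.
  by rewrite !(entry_sub_constant thr th').
rewrite /= (fP_shift _ thE) (fQ_shift _ thE).
have [] := cl 1 ltr01; rewrite th'// !derive1_cst !scaler0 /cst.
by move=> ? <- <- <- <-.
Qed.

Lemma active_power_sharing (mstar t : R) i : 0 <= t ->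
  (forall i, droop g i 0 = mstar) ->
  mstar * (fP g (theta t) (voltage g v) i 0 / Srated g i 0)
  = omega_nom g - omega_syn.
Proof.
move=> /steady_state_equations[+ + _ _ _] m.
move=> /matrixP/(_ i 0) + /matrixP/(_ i 0); rewrite -mulmxA.
set X := dg _ *m _; have : X i 0 = _ := dg_mulE _ _ i.
rewrite SinvE m => <-; rewrite !mxE; lra.
Qed.

Lemma lambda_average (t : R) i : (0 < n)%N -> 0 <= t ->
  lambda i 0 = average (Sinv g *m fQ g (theta t) (voltage g v)).
Proof.
move=> n0 /steady_state_equations[_ _ _ + L0].
rewrite L0 scaler0 oppr0 add0r.
set Y := Sinv g *m _ => /matrixP E.
(* By consensus [lambda i 0] is the average of [lambda], so two averages are compared. *)
rewrite -(average_const n0 (fun j => laplacian_ker L0 j i)) !averageE.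
(* Subtracting the zero-sum vector [laplacian g *m zeta] makes the two sums agree term by term. *)
congr (_ * _); have <- : \sum_j (Y j 0 - (laplacian g *m zeta) j 0)
    = \sum_j Y j 0 by rewrite sumrB sum_laplacian subr0.
move: (laplacian g *m zeta) Y E => X Y E.
by apply: eq_bigr => j _; have := E j 0; rewrite !mxE; lra.
Qed.

(* The steady voltage equation at node [i], divided by [V_i^star]. *)
Lemma reactive_power_deviation (t : R) i : (0 < n)%N -> 0 <= t ->
  let Q := fQ g (theta t) (voltage g v) in
  Q i 0 / Srated g i 0 - average (Sinv g *m Q)
  = beta g * (1 - voltage g v i 0 / Vstar g i 0)
    - rho g i (v i 0) * (v i 0 / Vstar g i 0).
Proof.
move=> n0 t0 /=; rewrite -(lambda_average i n0 t0).
have [_ _ /matrixP/(_ i 0) + _ _] := steady_state_equations t0.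
have V0 := Vstar_gt0 i.
(* Hence [1 - V / Vstar] is minus the saturation over [Vstar], the source of the [beta] term. *)
have -> : voltage g v i 0 = Vstar g i 0 + saturation g v i 0 by rewrite mxE.
set A := rho_mx g v *m v; have : A i 0 = _ := dg_mulE _ _ i.
set B := dg (Vstar g) *m _; have : B i 0 = _ := dg_mulE _ _ i.
move: (saturation g v) => s.
have Vn0 : Vstar g i 0 != 0 by rewrite gt_eqF.
move=> BE AE.
have -> : (- A - beta g *: s + B) i 0 = - A i 0 - beta g * s i 0 + B i 0.
  by rewrite !mxE.
have -> : A i 0 = rho g i (v i 0) * v i 0 by rewrite AE [(\col__ _) _ _]mxE.
have -> : B i 0 = Vstar g i 0 * (lambda i 0
    - fQ g (theta t) (voltage g v) i 0 / Srated g i 0).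
  by rewrite BE -SinvE; congr (_ * _); rewrite !mxE.
rewrite [X in _ = X -> _]mxE.
move: (fQ g _ _ i 0 / _) (lambda i 0) (s i 0) => q l si E.
have -> : q - l = (- (rho g i (v i 0) * v i 0) - beta g * si) / Vstar g i 0.
  by apply: (mulIf Vn0); rewrite divfK//; lra.
by field.
Qed.

End SteadyState.

Theorem proposition1 (R : realType) (n : nat) (n_gt0 : (0 < n)%N)
    (g : microgrid R n) (omega_syn : R) (theta : R -> 'cV[R]_n)
    (Omega v lambda zeta : 'cV[R]_n)
    (Hss : steady_state g omega_syn theta Omega v lambda zeta)
    (mstar : R) (mstar_gt0 : 0 < mstar)
    (Hdroop : forall i : 'I_n, droop g i 0 = mstar)
    (t : R) (t_ge0 : 0 <= t) :
  let V := voltage g v in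
  let P := fP g (theta t) V in
  let Q := fQ g (theta t) V in
  let alphaQ := average (Sinv g *m Q) in
  [/\ (forall i j : 'I_n, P i 0 / Srated g i 0 = P j 0 / Srated g j 0)
      /\ omega_syn = omega_nom g - mstar * average (Sinv g *m P),
      forall i : 'I_n, Vmin g i 0 < V i 0 < Vmax g i 0,
      Nsat g v = set0 ->
        forall i : 'I_n,
          `|Q i 0 / Srated g i 0 - alphaQ|
            = beta g * `|1 - V i 0 / Vstar g i 0|
    & Nsat g v != set0 ->
        (forall i : 'I_n, i \notin Nsat g v ->
          `|Q i 0 / Srated g i 0 - alphaQ|
            = beta g * `|1 - V i 0 / Vstar g i 0|)
        /\
        (forall i : 'I_n, i \in Nsat g v ->
          `|Q i 0 / Srated g i 0 - alphaQ|
            <= beta g * `|1 - V i 0 / Vstar g i 0|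
               + rho g i (v i 0) * `|v i 0 / Vstar g i 0|)].
Proof.
move=> V P Q alphaQ.
have b0 := beta_gt0 g.
have QE i : Q i 0 / Srated g i 0 - alphaQ = _ :=
  reactive_power_deviation Hss i n_gt0 t_ge0.
have PE i : mstar * (P i 0 / Srated g i 0) = _ :=
  active_power_sharing Hss i t_ge0 Hdroop.
have unsat i : i \notin Nsat g v ->
    `|Q i 0 / Srated g i 0 - alphaQ| = beta g * `|1 - V i 0 / Vstar g i 0|.
  rewrite inE -leNgt => r0; rewrite QE.
  have -> : rho g i (v i 0) = 0 by apply/le_anti; rewrite r0 rho_ge0.
  by rewrite mul0r subr0 normrM gtr0_norm.
have Peq i : P i 0 / Srated g i 0 = (omega_nom g - omega_syn) / mstar.
  by rewrite -(PE i) [mstar * _]mulrC mulfK// gt_eqF.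
split=> [|i|sat0 i|_].
- split=> [i j|]; first by rewrite !Peq.
  (* The average is the common ratio, so the frequency formula is [PE] solved for [omega_syn]. *)
  rewrite (@average_const _ _ _ ((omega_nom g - omega_syn) / mstar))//.
    by rewrite mulrC divfK ?gt_eqF// subKr.
  by move=> i; rewrite SinvE.
- exact: voltage_bounds.
- by apply: unsat; rewrite sat0 inE.
(* At saturated nodes the triangle inequality separates the two terms of the deviation. *)
- split=> // i _; rewrite QE; apply: le_trans (ler_normB _ _) _.
  by rewrite !normrM (gtr0_norm b0) (ger0_norm (rho_ge0 _ _ _)).
Qed.
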